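(* Consider the equilibria on the $y$-axis of the Hill four-body problem with oblate tertiary. For $\mu\in(0,1/2]$ and for the parameter $c$ negative and small enough, $\Omega_{zz}$ is always negative, the coefficients $A$ and $B$ are always positive, and the value of the discriminant $D$ changes from positive to negative values. Consequently, one pair of eigenvalues is always purely imaginary, and there exists $\mu_*$, depending on $c$, where the other two pairs of eigenvalues change from being purely imaginary to being complex conjugate. The linear stability changes from center $\times$ center $\times$ center type to center $\times$ complex-saddle type.
   Context: The Hill four-body problem with oblate tertiary is the system $\ddot x-2\dot y=\Omega_x$, $\ddot y+2\dot x=\Omega_y$, $\ddot z=\Omega_z$ with $$\Omega(x,y,z)=\tfrac12(\lambda_2x^2+\lambda_1y^2-z^2)+\frac1{r}-\frac{c}{r^3}+\frac{3cz^2}{r^5},\qquad r=(x^2+y^2+z^2)^{1/2}.$$ Here $m_1\ge m_2\ge m_3$ with $m_1+m_2+m_3=1$ are the masses of the primary, secondary and oblate tertiary, $\mu=\frac{m_2}{m_1+m_2}$, $R_3$ is the average radius of the tertiary, $C_{20}<0$ is its zonal harmonic coefficient, $c=m_3^{-2/3}R_3^2C_{20}/2$, $v=\left(\frac{1}{1-\frac32R_3^2C_{20}}\right)^{1/3}$, $d=\sqrt{1-v^2(4-v^2)(\mu-\mu^2)}$, $\lambda_1=\frac32(1-d)$ and $\lambda_2=\frac32(1+d)$. The $y$-axis equilibria are $(0,\pm r_y^*,0)$, where $r_y^*>0$ is the unique positive solution of $\lambda_1r^5-r^2+3c=0$. The eigenvalues $\rho$ are those of the linearized system at the equilibrium, in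 the variables $(x,y,z,\dot x,\dot y,\dot z)$; they satisfy the characteristic equation $(\rho^2-\Omega_{zz})(\rho^4+A\rho^2+B)=0$ with $A=4-\Omega_{xx}-\Omega_{yy}$, $B=\Omega_{xx}\Omega_{yy}$, and $D=A^2-4B$, the second derivatives being evaluated at the equilibrium. *)

(* Defs.v *)
From HB Require Import structures.
From mathcomp Require Import all_boot all_order all_algebra.
From mathcomp Require Import all_classical all_reals all_analysis.
From mathcomp.real_closed Require Import complex.
Set Implicit Arguments.
Unset Strict Implicit.
Unset Printing Implicit Defensive.
Import Order.TTheory GRing.Theory Num.Theory.
Import numFieldNormedType.Exports.
Local Open Scope ring_scope.
Local Open Scope complex_scope.

(* The masses m1 >= m2 >= m3 with m1 + m2 + m3 = 1 enter the system only through
   m3, which ranges over ]0, 1/3], and mu = m2 / (m1 + m2), in ]0, 1/2]. *)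
Definition c_par (R : realType) (m3 R3 C20 : R) : R :=
  m3 `^ (- (2 / 3)) * R3 ^+ 2 * C20 / 2.

Definition v_par (R : realType) (R3 C20 : R) : R :=
  (1 / (1 - 3 / 2 * R3 ^+ 2 * C20)) `^ (1 / 3).

Definition d_par (R : realType) (v mu : R) : R :=
  Num.sqrt (1 - v ^+ 2 * (4 - v ^+ 2) * (mu - mu ^+ 2)).

Definition lambda1 (R : realType) (v mu : R) : R := 3 / 2 * (1 - d_par v mu).

Definition lambda2 (R : realType) (v mu : R) : R := 3 / 2 * (1 + d_par v mu).

Definition Omega (R : realType) (l1 l2 c x y z : R) : R :=
  let r := Num.sqrt (x ^+ 2 + y ^+ 2 + z ^+ 2) in
  2^-1 * (l2 * x ^+ 2 + l1 * y ^+ 2 - z ^+ 2)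
  + 1 / r - c / r ^+ 3 + 3 * c * z ^+ 2 / r ^+ 5.

Definition Omega_x (R : realType) (l1 l2 c x y z : R) : R :=
  derive1 (fun t => Omega l1 l2 c t y z) x.
Definition Omega_y (R : realType) (l1 l2 c x y z : R) : R :=
  derive1 (fun t => Omega l1 l2 c x t z) y.
Definition Omega_z (R : realType) (l1 l2 c x y z : R) : R :=
  derive1 (fun t => Omega l1 l2 c x y t) z.

Definition Omega_xx (R : realType) (l1 l2 c x y z : R) : R :=
  derive1 (fun t => Omega_x l1 l2 c t y z) x.
Definition Omega_yy (R : realType) (l1 l2 c x y z : R) : R :=
  derive1 (fun t => Omega_y l1 l2 c x t z) y.
Definition Omega_zz (R : realType) (l1 l2 c x y z : R) : R :=
  derive1 (fun t => Omega_z l1 l2 c x y t) z.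

(* The equations of motion as a first-order system; the coordinates of the
   phase space are ordered (x, y, z, x', y', z'). *)
Definition hill_field (R : realType) (l1 l2 c : R) (w : 'rV[R]_6) : 'rV[R]_6 :=
  let x := w 0 0 in let y := w 0 1 in let z := w 0 2 in
  let vx := w 0 3 in let vy := w 0 4 in let vz := w 0 5 in
  \row_(j < 6) [:: vx; vy; vz;
                   2 * vy + Omega_x l1 l2 c x y z;
                   - 2 * vx + Omega_y l1 l2 c x y z;
                   Omega_z l1 l2 c x y z]`_j.

Definition y_axis_state (R : realType) (y : R) : 'rV[R]_6 :=
  \row_(j < 6) [:: 0; y; 0; 0; 0; 0]`_j.

(* The unique positive solution; [get] would return an arbitrary real if there
   were none. *)
Definition ry_star (R : realType) (l1 c : R) : R :=
  get [set r : R | 0 < r /\ l1 * r ^+ 5 - r ^+ 2 + 3 * c = 0]%classic.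

(* The library's [jacobian f p] acts on row vectors, i.e. it is the transpose of
   the usual matrix of partial derivatives, which has the same spectrum. *)
Definition linearization (R : realType) (l1 l2 c y : R) : 'M[R]_6 :=
  jacobian (hill_field l1 l2 c) (y_axis_state y).

Definition hillA (R : realType) (l1 l2 c x y z : R) : R :=
  4 - Omega_xx l1 l2 c x y z - Omega_yy l1 l2 c x y z.
Definition hillB (R : realType) (l1 l2 c x y z : R) : R :=
  Omega_xx l1 l2 c x y z * Omega_yy l1 l2 c x y z.
Definition hillD (R : realType) (l1 l2 c x y z : R) : R :=
  hillA l1 l2 c x y z ^+ 2 - 4 * hillB l1 l2 c x y z.

Definition complexify (R : realType) (J : 'M[R]_6) : 'M[R[i]]_6 :=
  map_mx (real_complex R) J.

(* [s] lists the complex eigenvalues of [J] with algebraic multiplicity. *)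
Definition has_spectrum (R : realType) (J : 'M[R]_6) (s : seq R[i]) : Prop :=
  char_poly (complexify J) = \prod_(rho <- s) ('X - rho%:P).

Definition purely_imaginary (R : realType) (rho : R[i]) : Prop :=
  complex.Re rho = 0 /\ complex.Im rho <> 0.

(* Diagonalizability excludes the secular terms that a repeated frequency could
   produce, so that the linear flow is a product of three planar centers. *)
Definition center_center_center (R : realType) (J : 'M[R]_6) : Prop :=
  diagonalizable (complexify J) /\
  exists w1 w2 w3 : R,
    [/\ 0 < w1, 0 < w2, 0 < w3 &
        has_spectrum J [:: 0 +i* w1; 0 -i* w1; 0 +i* w2; 0 -i* w2;
                           0 +i* w3; 0 -i* w3]].

(* The six listed eigenvalues are pairwise distinct, so diagonalizability is
   automatic. *)
Definition center_complex_saddle (R : realType) (J : 'M[R]_6) : Prop :=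
  exists w a b : R,
    [/\ 0 < w, 0 < a, 0 < b &
        has_spectrum J [:: 0 +i* w; 0 -i* w; a +i* b; a -i* b;
                           (- a) +i* b; (- a) -i* b]].

(* Main.v *)
(** At a [y]-axis equilibrium the equation [l1 = r^-3 - 3 c r^-5] turns the second
    derivatives into functions of [d] and of the small quantity [q = - 6 c r^-5]:
    [Omega_xx = 3 d], [Omega_yy = 3 l1 + q], [Omega_zz = - 1 - l1 - q].  As
    [r > 1], [q] is at most [- 6 c], so the signs of [Omega_zz], [A] and [B] are
    immediate.  The discriminant is strictly increasing in [d], because [q] is
    nonincreasing in [d], and [d] is strictly decreasing in [mu]; it is positive
    near [mu = 0] ([d] close to 1) and negative at [mu = 2/5], so it changes sign
    exactly once.  The vertical frequency satisfies [- Omega_zz > 1 >= A], hence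
    never resonates with the planar ones: when [D > 0] all six eigenvalues are
    distinct and the linearization is diagonalizable. *)

Require Import Defs.
From HB Require Import structures.
From mathcomp Require Import all_boot all_order all_algebra.
From mathcomp Require Import all_classical all_reals all_analysis.
From mathcomp.real_closed Require Import complex.
From mathcomp Require Import ring lra.
Set Implicit Arguments.
Unset Strict Implicit.
Unset Printing Implicit Defensive.
Import Order.TTheory GRing.Theory Num.Theory.
Import numFieldNormedType.Exports.
Local Open Scope ring_scope.
Local Open Scope complex_scope.

(* Its partial derivatives are [- x * inv_radius x y z ^+ 3], etc.: in this
   variable all the derivatives below are polynomial. *)
Definition inv_radius (R : realType) (x y z : R) : R :=
  (Num.sqrt (x ^+ 2 + y ^+ 2 + z ^+ 2))^-1.

Definition force_factor (R : realType) (c x y z : R) : R :=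
  let h := inv_radius x y z in
  - h ^+ 3 + 3 * c * h ^+ 5 - 15 * c * (z ^+ 2 * h ^+ 7).

Definition force_x (R : realType) (l2 c x y z : R) : R :=
  x * (l2 + force_factor c x y z).
Definition force_y (R : realType) (l1 c x y z : R) : R :=
  y * (l1 + force_factor c x y z).
Definition force_z (R : realType) (c x y z : R) : R :=
  z * (- 1 + force_factor c x y z + 6 * c * inv_radius x y z ^+ 5).

(** * Derivatives of the potential away from the origin *)

Section Derivatives.
Variable R : realType.
Implicit Types (X Y Z f g : R -> R) (a b c k x y z t : R).

(* Pointwise forms of the library's [is_derive] rules, composed explicitly below
   because instance resolution is very slow on the expressions at hand. *)
Lemma derD f g a b t : is_derive t 1 f a -> is_derive t 1 g b ->
  is_derive t 1 (fun u => f u + g u) (a + b).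
Proof. exact: is_deriveD. Qed.

Lemma derN f a t : is_derive t 1 f a -> is_derive t 1 (fun u => - f u) (- a).
Proof. exact: is_deriveN. Qed.

Lemma derM f g a b t : is_derive t 1 f a -> is_derive t 1 g b ->
  is_derive t 1 (fun u => f u * g u) (f t * b + g t * a).
Proof. exact: is_deriveM. Qed.

Lemma derX n f a t : is_derive t 1 f a ->
  is_derive t 1 (fun u => f u ^+ n) (n%:R * f t ^+ n.-1 * a).
Proof. by move=> df; have := is_deriveX n df; rewrite exprfctE. Qed.

Lemma derZ k f a t : is_derive t 1 f a ->
  is_derive t 1 (fun u => k * f u) (k * a).
Proof. exact: is_deriveZ. Qed.

Lemma derI t : is_derive t 1 (fun u : R => u) 1.
Proof. exact: is_derive_id. Qed.

Lemma derC k t : is_derive t 1 (fun=> k) 0.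
Proof. exact: is_derive_cst. Qed.

(** Stated along an arbitrary curve [(X, Y, Z)]: one computation then serves the partial
    derivatives, where a single coordinate moves, and the directional derivatives of the field,
    where all of them move along a line. *)
Lemma is_derive_inv_radius X Y Z t (dx dy dz : R) :
  is_derive t 1 X dx -> is_derive t 1 Y dy -> is_derive t 1 Z dz ->
  0 < X t ^+ 2 + Y t ^+ 2 + Z t ^+ 2 ->
  is_derive t 1 (fun u => inv_radius (X u) (Y u) (Z u))
    (- inv_radius (X t) (Y t) (Z t) ^+ 3 * (X t * dx + Y t * dy + Z t * dz)).
Proof.
move=> dx_ dy_ dz_ s0.
have n0 : Num.sqrt (X t ^+ 2 + Y t ^+ 2 + Z t ^+ 2) != 0.
  by rewrite sqrtr_eq0 -ltNge.
have ds := is_derive1_comp (f := Num.sqrt)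
  (g := fun u => X u ^+ 2 + Y u ^+ 2 + Z u ^+ 2) (is_derive1_sqrt s0)
  (derD (derD (derX 2 dx_) (derX 2 dy_)) (derX 2 dz_)).
apply: (is_derive_eq (@is_deriveV _
  (fun u => Num.sqrt (X u ^+ 2 + Y u ^+ 2 + Z u ^+ 2)) _ _ _ n0 ds)).
rewrite /inv_radius /GRing.scale /=.
move: n0; set r := Num.sqrt _ => r0.
by field.
Qed.

Lemma is_derive_force_factor c X Y Z t (dx dy dz : R) :
  is_derive t 1 X dx -> is_derive t 1 Y dy -> is_derive t 1 Z dz ->
  0 < X t ^+ 2 + Y t ^+ 2 + Z t ^+ 2 ->
  let h := inv_radius (X t) (Y t) (Z t) in
  is_derive t 1 (fun u => force_factor c (X u) (Y u) (Z u))
    ((3 * h ^+ 5 - 15 * c * h ^+ 7 + 105 * c * Z t ^+ 2 * h ^+ 9)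
       * (X t * dx + Y t * dy + Z t * dz)
     - 30 * c * Z t * dz * h ^+ 7).
Proof.
move=> dx_ dy_ dz_ s0 h; rewrite /force_factor /=.
have dh := is_derive_inv_radius dx_ dy_ dz_ s0.
apply: (is_derive_eq (derD (derD (derN (derX 3 dh)) (derZ (3 * c) (derX 5 dh)))
  (derN (derZ (15 * c) (derM (derX 2 dz_) (derX 7 dh)))))).
by rewrite -/h /=; ring.
Qed.

Lemma is_derive_force_z c X Y Z t (dx dy dz : R) :
  is_derive t 1 X dx -> is_derive t 1 Y dy -> is_derive t 1 Z dz ->
  0 < X t ^+ 2 + Y t ^+ 2 + Z t ^+ 2 ->
  let h := inv_radius (X t) (Y t) (Z t) in
  is_derive t 1 (fun u => force_z c (X u) (Y u) (Z u))
    (dz * (- 1 + force_factor c (X t) (Y t) (Z t) + 6 * c * h ^+ 5)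
     + Z t * ((3 * h ^+ 5 - 45 * c * h ^+ 7 + 105 * c * Z t ^+ 2 * h ^+ 9)
       * (X t * dx + Y t * dy + Z t * dz)
     - 30 * c * Z t * dz * h ^+ 7)).
Proof.
move=> dx_ dy_ dz_ s0 h; rewrite /force_z.
have dh := is_derive_inv_radius dx_ dy_ dz_ s0.
have dF := is_derive_force_factor c dx_ dy_ dz_ s0.
apply: (is_derive_eq (derM dz_ (derD (derD (derC (- 1) t) dF)
  (derZ (6 * c) (derX 5 dh))))).
by rewrite -/h /=; ring.
Qed.

(** The coefficients of [dx], [dy], [dz] identify [force_x], [force_y], [force_z] as the gradient of
    the potential. *)
Lemma is_derive_Omega (l1 l2 : R) c X Y Z t (dx dy dz : R) :
  is_derive t 1 X dx -> is_derive t 1 Y dy -> is_derive t 1 Z dz ->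
  0 < X t ^+ 2 + Y t ^+ 2 + Z t ^+ 2 ->
  is_derive t 1 (fun u => Omega l1 l2 c (X u) (Y u) (Z u))
    (dx * force_x l2 c (X t) (Y t) (Z t) + dy * force_y l1 c (X t) (Y t) (Z t)
     + dz * force_z c (X t) (Y t) (Z t)).
Proof.
move=> dx_ dy_ dz_ s0.
have -> : (fun u => Omega l1 l2 c (X u) (Y u) (Z u)) = fun u =>
    2^-1 * (l2 * X u ^+ 2 + l1 * Y u ^+ 2 - Z u ^+ 2)
    + inv_radius (X u) (Y u) (Z u) - c * inv_radius (X u) (Y u) (Z u) ^+ 3
    + 3 * c * (Z u ^+ 2 * inv_radius (X u) (Y u) (Z u) ^+ 5).
  by apply/funext => u; rewrite /Omega /= div1r /inv_radius !exprVn mulrA.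
have dh := is_derive_inv_radius dx_ dy_ dz_ s0.
apply: (is_derive_eq (derD (derD (derD
  (derZ 2^-1 (derD (derD (derZ l2 (derX 2 dx_)) (derZ l1 (derX 2 dy_)))
                   (derN (derX 2 dz_)))) dh) (derN (derZ c (derX 3 dh))))
  (derZ (3 * c) (derM (derX 2 dz_) (derX 5 dh))))).
rewrite /force_x /force_y /force_z /force_factor /=.
by field.
Qed.

Lemma Omega_xE (l1 l2 : R) c x y z : 0 < x ^+ 2 + y ^+ 2 + z ^+ 2 ->
  Omega_x l1 l2 c x y z = force_x l2 c x y z.
Proof.
move=> s0; rewrite /Omega_x derive1E.
have := is_derive_Omega l1 l2 c (derI x) (derC y x) (derC z x) s0.
by case=> _ ->; rewrite mul1r !mul0r !addr0.
Qed.

Lemma Omega_yE (l1 l2 : R) c x y z : 0 < x ^+ 2 + y ^+ 2 + z ^+ 2 ->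
  Omega_y l1 l2 c x y z = force_y l1 c x y z.
Proof.
move=> s0; rewrite /Omega_y derive1E.
have := is_derive_Omega l1 l2 c (derC x y) (derI y) (derC z y) s0.
by case=> _ ->; rewrite mul1r !mul0r !addr0 add0r.
Qed.

Lemma Omega_zE (l1 l2 : R) c x y z : 0 < x ^+ 2 + y ^+ 2 + z ^+ 2 ->
  Omega_z l1 l2 c x y z = force_z c x y z.
Proof.
move=> s0; rewrite /Omega_z derive1E.
have := is_derive_Omega l1 l2 c (derC x z) (derC y z) (derI z) s0.
by case=> _ ->; rewrite mul1r !mul0r !add0r.
Qed.

End Derivatives.

(** * Differentiability of the vector field at a state on the [y]-axis *)

Section Linearization.
Variable R : realType.

(** The difference [f - g] vanishes near [a], so it is negligible and has differential zero there;
    then [f = (f - g) + g] inherits differentiability from [g]. *)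
Lemma near_eq_differentiable (V W : normedModType R) (f g : V -> W) (a : V) :
  (\near a, f a = g a) -> differentiable g a -> differentiable f a.
Proof.
move=> fg dg.
suff dk : differentiable (f \- g) a.
  have -> : f = (f \- g) \+ g by apply/funext => x /=; rewrite subrK.
  exact: differentiableD.
have keq : (f \- g) \o shift a = cst ((f \- g) a) + \0 +o_ (0 : V) id.
  apply/eqaddoP => _/posnumP[e]; near=> h.
  have fgh : f (h + a) = g (h + a).
    rewrite -[a]subr0; near: h.
    by have := fg; rewrite (near_shift 0).
  have -> : ((f \- g) \o shift a - (cst ((f \- g) a) + \0)) h = 0.
    by rewrite !fctE /= (nbhs_singleton fg) fgh !subrr addr0 subr0.
  by rewrite normr0 mulr_ge0.
have dk0 : 'd (f \- g) a = \0 :> (V -> W).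
  by apply: (diff_unique (df := \0)) => // x; exact: cvg_cst.
by apply/diff_locallyP; rewrite dk0; split => // x; exact: cvg_cst.
Unshelve. all: by end_near. Qed.

Lemma differentiable_row (V : normedModType R) n (F : V -> 'I_n -> R) (a : V) :
  (forall j, differentiable (F ^~ j) a) ->
  differentiable (fun v => \row_j F v j) a.
Proof.
move=> dF.
have -> : (fun v => \row_j F v j) =
    \sum_(j < n) (fun v => F v j *: delta_mx 0 j : 'rV[R]_n).
  apply/funext => v; rewrite fct_sumE [LHS]row_sum_delta.
  by apply: eq_bigr => j _; rewrite mxE.
by apply: differentiable_sum => j; exact: differentiableZl.
Qed.


Lemma differentiable_pow (V : normedModType R) n (f : V -> R) (a : V) :
  differentiable f a -> differentiable (fun v => f v ^+ n.+1) a.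
Proof.
move=> df; rewrite (_ : (fun _ => _) = f ^+ n.+1); first exact: differentiableX.
by apply/funext => v; rewrite exprfctE.
Qed.

Section Composition.
Variables (V : normedModType R) (p : V) (X Y Z : V -> R).
Hypotheses (dX_ : differentiable X p) (dY_ : differentiable Y p).
Hypotheses (dZ_ : differentiable Z p).
Hypothesis s0 : 0 < X p ^+ 2 + Y p ^+ 2 + Z p ^+ 2.

Lemma differentiable_inv_radius :
  differentiable (fun u => inv_radius (X u) (Y u) (Z u)) p.
Proof.
have ds : differentiable (fun u => X u ^+ 2 + Y u ^+ 2 + Z u ^+ 2) p.
  apply: differentiableD; last exact: (differentiable_pow 1 dZ_).
  by apply: differentiableD; [exact: (differentiable_pow 1 dX_)
                             |exact: (differentiable_pow 1 dY_)].
have dr : differentiable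
    (fun u => Num.sqrt (X u ^+ 2 + Y u ^+ 2 + Z u ^+ 2)) p.
  apply: (differentiable_comp ds (g := Num.sqrt)).
  by apply/derivable1_diffP; case: (is_derive1_sqrt s0).
by apply: (differentiableV dr); rewrite sqrtr_eq0 -ltNge.
Qed.

Lemma differentiable_force_factor (c : R) :
  differentiable (fun u => force_factor c (X u) (Y u) (Z u)) p.
Proof.
have dh := differentiable_inv_radius.
apply: differentiableB.
  apply: differentiableD; first exact/differentiableN/(differentiable_pow 2 dh).
  exact/(differentiableZ (3 * c))/(differentiable_pow 4 dh).
apply/(differentiableZ (15 * c)).
by apply: differentiableM; [exact: (differentiable_pow 1 dZ_)
                           |exact: (differentiable_pow 6 dh)].
Qed.

Lemma differentiable_force_x (l2 c : R) :
  differentiable (fun u => force_x l2 c (X u) (Y u) (Z u)) p.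
Proof.
apply: differentiableM => //; apply: differentiableD => //.
exact: differentiable_force_factor.
Qed.

Lemma differentiable_force_y (l1 c : R) :
  differentiable (fun u => force_y l1 c (X u) (Y u) (Z u)) p.
Proof.
apply: differentiableM => //; apply: differentiableD => //.
exact: differentiable_force_factor.
Qed.

Lemma differentiable_force_z (c : R) :
  differentiable (fun u => force_z c (X u) (Y u) (Z u)) p.
Proof.
apply: differentiableM => //; apply: differentiableD.
  apply: differentiableD => //; exact: differentiable_force_factor.
exact/(differentiableZ (6 * c))/(differentiable_pow 4 differentiable_inv_radius).
Qed.

End Composition.

(** The closed forms of the forces are justified only off the origin, so this field is compared with
    [hill_field] only near the equilibrium. *)
Definition explicit_field (l1 l2 c : R) (w : 'rV[R]_6) : 'rV[R]_6 :=
  let x := w 0 0 in let y := w 0 1 in let z := w 0 2 in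
  \row_(j < 6) [:: w 0 3; w 0 4; w 0 5;
                   2 * w 0 4 + force_x l2 c x y z;
                   - 2 * w 0 3 + force_y l1 c x y z;
                   force_z c x y z]`_j.

Variables (l1 l2 c y : R).
Hypothesis y0 : y != 0.
Let p := y_axis_state y.

Lemma y_axis_stateE : (p 0 0 = 0) * (p 0 1 = y) * (p 0 2 = 0).
Proof. by rewrite /p !mxE. Qed.

Lemma near_hill_field :
  \near p, hill_field l1 l2 c p = explicit_field l1 l2 c p.
Proof.
have cy : ((fun w : 'rV[R]_6 => w 0 1) @ p --> (p 0 1 : R))%classic.
  exact: coord_continuous.
have ny : \forall w \near p, (w : 'rV[R]_6) 0 1 != 0.
  by apply: (cvgr_neq0 _ cy); rewrite y_axis_stateE.
near=> w.
have w1 : w 0 1 != 0 by near: w.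
have s0 : 0 < w 0 0 ^+ 2 + w 0 1 ^+ 2 + w 0 2 ^+ 2.
  by rewrite ltr_wpDr ?sqr_ge0// ltr_wpDl ?sqr_ge0// exprn_even_gt0.
by rewrite /hill_field /explicit_field Omega_xE// Omega_yE// Omega_zE.
Unshelve. all: by end_near. Qed.

Lemma differentiable_explicit_field : differentiable (explicit_field l1 l2 c) p.
Proof.
have dc (i : 'I_6) : differentiable (fun w : 'rV[R]_6 => w 0 i) p.
  exact: differentiable_coord.
have s0 : 0 < p 0 0 ^+ 2 + p 0 1 ^+ 2 + p 0 2 ^+ 2.
  by rewrite !y_axis_stateE expr0n add0r addr0 exprn_even_gt0.
apply: differentiable_row.
case; do 6?[case=> //=] => _.
- apply: differentiableD; first exact: (differentiableZ 2).
  exact: differentiable_force_x.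
- apply: differentiableD; first exact: (differentiableZ (-2)).
  exact: differentiable_force_y.
- exact: differentiable_force_z.
Qed.

Lemma differentiable_hill_field : differentiable (hill_field l1 l2 c) p.
Proof.
exact: near_eq_differentiable near_hill_field differentiable_explicit_field.
Qed.

End Linearization.

(** * Second derivatives of the potential and derivative of the field on the [y]-axis *)

Section Jacobian.
Variable R : realType.
Variables (l1 l2 c y : R).
Hypothesis y0 : y != 0.
Let p := y_axis_state y.
Let h := inv_radius 0 y 0.

Let pos_sum x z : 0 < x ^+ 2 + y ^+ 2 + z ^+ 2.
Proof. by rewrite ltr_wpDr ?sqr_ge0// ltr_wpDl ?sqr_ge0// exprn_even_gt0. Qed.

Lemma Omega_xx_y_axis :
  Omega_xx l1 l2 c 0 y 0 = l2 + force_factor c 0 y 0.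
Proof.
rewrite /Omega_xx derive1E.
rewrite (_ : (fun t => _) = fun t => force_x l2 c t y 0); last first.
  by apply/funext => t; rewrite Omega_xE.
have dF := is_derive_force_factor c (derI 0) (derC y 0) (derC 0 0) (pos_sum 0 0).
case: (derM (derI 0) (derD (derC l2 0) dF)) => _ ->.
by rewrite mul0r add0r mulr1.
Qed.

Lemma Omega_yy_y_axis : Omega_yy l1 l2 c 0 y 0 =
  l1 + force_factor c 0 y 0 + y ^+ 2 * (3 * h ^+ 5 - 15 * c * h ^+ 7).
Proof.
rewrite /Omega_yy derive1E.
(* Here [x = z = 0], so moving [y] can reach the origin and the closed form holds only near [y]; in
   the other two directions [y] itself keeps the radius positive. *)
have ny : \forall t \near y, t != 0.
  by apply: (@cvgr_neq0 R R R (nbhs y) _ id y _ y0); exact: cvg_id.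
rewrite (@near_eq_derive _ _ _ _ (fun t => force_y l1 c 0 t 0)); last first.
  near=> t; apply: Omega_yE.
  by rewrite expr0n add0r addr0 exprn_even_gt0//=; near: t.
have dF := is_derive_force_factor c (derC 0 y) (derI y) (derC 0 y) (pos_sum 0 0).
case: (derM (derI y) (derD (derC l1 y) dF)) => _ ->.
by rewrite -/h; ring.
Unshelve. all: by end_near. Qed.

Lemma Omega_zz_y_axis : Omega_zz l1 l2 c 0 y 0 =
  - 1 + force_factor c 0 y 0 + 6 * c * h ^+ 5.
Proof.
rewrite /Omega_zz derive1E.
rewrite (_ : (fun t => _) = fun t => force_z c 0 y t); last first.
  by apply/funext => t; rewrite Omega_zE.
case: (is_derive_force_z c (derC 0 0) (derC y 0) (derI 0) (pos_sum 0 0)) => _ ->.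
by rewrite -/h; ring.
Qed.

Lemma derive_hill_field (v : 'rV[R]_6) : 'D_v (hill_field l1 l2 c) p =
  \row_(j < 6) [:: v 0 3; v 0 4; v 0 5;
                   2 * v 0 4 + v 0 0 * Omega_xx l1 l2 c 0 y 0;
                   - 2 * v 0 3 + v 0 1 * Omega_yy l1 l2 c 0 y 0;
                   v 0 2 * Omega_zz l1 l2 c 0 y 0]`_j.
Proof.
rewrite (near_eq_derive _ (near_hill_field l1 l2 c y0)).
rewrite derive_mx; last exact/diff_derivable/differentiable_explicit_field.
apply/rowP => j; rewrite !mxE.
have dL (i : 'I_6) : is_derive (0 : R) 1 (fun t : R => (t *: v + p) 0 i) (v 0 i).
  rewrite (_ : (fun t : R => _) = fun t : R => t * v 0 i + p 0 i); last first.
    by apply/funext => t; rewrite !mxE.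
  by apply: (is_derive_eq (derD (derM (derI 0) (derC (v 0 i) 0))
    (derC (p 0 i) 0)));
    rewrite mul0r addr0 add0r mulr1.
(* A directional derivative at [p] has the same difference quotient as the one-variable function
   [t |-> f (t *: v + p)] at [0], to which the curve lemmas apply. *)
have along (f : 'rV[R]_6 -> R) a :
    is_derive (0 : R) 1 (fun t : R => f (t *: v + p)) a -> 'D_v f p = a.
  case=> _ <-; rewrite /derive; set g1 := fun t => t^-1 *: _.
  set g2 := fun t => t^-1 *: _; suff -> : g1 = g2 by [].
  by apply/funext => t; rewrite /g1 /g2 /= addr0 scale0r add0r [_%:A]mulr1.
have pE (i : 'I_6) : ((0 : R) *: v + p) 0 i = p 0 i by rewrite scale0r add0r.
have p0 : p 0 0 = 0 by rewrite mxE.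
have p1 : p 0 1 = y by rewrite mxE.
have p2 : p 0 2 = 0 by rewrite mxE.
have s0 : 0 < (0 *: v + p) 0 0 ^+ 2 + (0 *: v + p) 0 1 ^+ 2
              + (0 *: v + p) 0 2 ^+ 2.
  by rewrite !pE p0 p1 p2.
have dF := is_derive_force_factor c (dL 0) (dL 1) (dL 2) s0.
rewrite Omega_xx_y_axis Omega_yy_y_axis Omega_zz_y_axis.
rewrite /explicit_field; under eq_fun do rewrite mxE.
move: j; case; do 6?[case=> //=] => _; apply: along.
- apply: (is_derive_eq (derD (derZ 2 (dL 4))
    (derM (dL 0) (derD (derC l2 0) dF)))).
  by rewrite !pE p0 p1 p2; ring.
- apply: (is_derive_eq (derD (derZ (- 2) (dL 3))
    (derM (dL 1) (derD (derC l1 0) dF)))).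
  by rewrite !pE p0 p1 p2 -/h; ring.
- apply: (is_derive_eq (is_derive_force_z c (dL 0) (dL 1) (dL 2) s0)).
  by rewrite !pE p0 p1 p2 -/h; ring.
Qed.

End Jacobian.

(** * Matrix of the linearization and its characteristic polynomial *)

(* Row [i] holds the partial derivatives of the field along coordinate [i]. *)
Definition linear_block (R : pzRingType) (a b g : R) : seq (seq R) :=
  [:: [:: 0; 0; 0; a; 0; 0];
      [:: 0; 0; 0; 0; b; 0];
      [:: 0; 0; 0; 0; 0; g];
      [:: 1; 0; 0; 0; - 2%:R; 0];
      [:: 0; 1; 0; 2%:R; 0; 0];
      [:: 0; 0; 1; 0; 0; 0]].

Lemma linearizationE (R : realType) (l1 l2 c y : R) : y != 0 ->
  linearization l1 l2 c y = \matrix_(i < 6, j < 6)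
    (nth [::] (linear_block (Omega_xx l1 l2 c 0 y 0) (Omega_yy l1 l2 c 0 y 0)
                            (Omega_zz l1 l2 c 0 y 0)) i)`_j.
Proof.
move=> y0; apply/row_matrixP => i; rewrite rowE /linearization.
rewrite -deriveEjacobian; last exact: differentiable_hill_field.
rewrite derive_hill_field//; apply/rowP => j; rewrite !mxE.
move: i j; case; do 6?[case=> //=] => ?; case; do 6?[case=> //=] => ?;
  by rewrite /= ?(mul0r, mul1r, mulr0, mulr1, add0r, addr0).
Qed.

(* First-row expansion of the determinant, in a form that computes on matrices
   with explicit entries. *)
Fixpoint laplace (R : pzRingType) n (f : nat -> nat -> R) : R :=
  if n is m.+1 then
    \sum_(0 <= j < m.+1)
      (-1) ^+ j * f 0 j * laplace m (fun i k => f i.+1 (bump j k))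
  else 1.

(** A fold over a concrete list of indices, unlike the big operator, unfolds by simplification. *)
Lemma laplaceS (R : pzRingType) n (f : nat -> nat -> R) :
  laplace n.+1 f =
  foldr (fun j s =>
          (-1) ^+ j * f 0 j * laplace n (fun i k => f i.+1 (bump j k)) + s)
        0 (iota 0 n.+1).
Proof. by rewrite /= unlock. Qed.

Lemma det_laplace (R : comPzRingType) n (f : nat -> nat -> R) :
  \det (\matrix_(i < n, j < n) f i j) = laplace n f.
Proof.
elim: n f => [|n IHn] f; first by rewrite det_mx00.
rewrite (expand_det_row _ ord0) /= big_mkord.
apply: eq_bigr => j _; rewrite mxE /cofactor add0n mulrCA mulrA -IHn.
by congr (_ * \det _); apply/matrixP => i k; rewrite !mxE.
Qed.

#[local] Arguments laplace : simpl never.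

Lemma char_poly_linear_block (R : comNzRingType) (a b g : R) :
  char_poly (\matrix_(i < 6, j < 6) (nth [::] (linear_block a b g) i)`_j) =
  ('X^2 - g%:P) * ('X^4 + (4 - a - b)%:P * 'X^2 + (a * b)%:P).
Proof.
(* The entries of the characteristic matrix, ['X] times the identity minus the block. *)
pose F (i j : nat) : {poly R} := (nth [::]
  [:: [:: 'X; 0; 0; - a%:P; 0; 0];
      [:: 0; 'X; 0; 0; - b%:P; 0];
      [:: 0; 0; 'X; 0; 0; - g%:P];
      [:: - 1; 0; 0; 'X; 2%:R; 0];
      [:: 0; - 1; 0; - 2%:R; 'X; 0];
      [:: 0; 0; - 1; 0; 0; 'X]] i)`_j.
have -> : char_poly (\matrix_(i < 6, j < 6) (nth [::] (linear_block a b g) i)`_j)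
    = \det (\matrix_(i < 6, j < 6) F i j).
  congr (\det _); apply/matrixP => i j; rewrite !mxE /F.
  move: i j; case; do 6?[case=> //=] => ?; case; do 6?[case=> //=] => ?;
    by rewrite ?(mulr0n, mulr1n, sub0r, subr0, polyC0, oppr0, polyC1, polyCN,
                 opprK, polyC_natr).
rewrite det_laplace.
(* Each round expands one row; the zero entries discard most minors before these are expanded in
   turn. *)
do 6 rewrite !laplaceS /F /bump /= ?(mulr0, mul0r, addr0, add0r).

rewrite !polyCB polyCM polyC_natr.
by ring.
Qed.

(** * The equilibrium radius and the sign of the discriminant *)

Section Equilibrium.
Variable R : realType.
Implicit Types (c d k l mu q r v : R).

(** Existence of a solution is what makes [get] meaningful. It follows from the intermediate value
    theorem, the quintic being negative at [1]. *)
Lemma ry_starP l c : 0 < l < 1 -> c < 0 ->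
  0 < ry_star l c /\ l * ry_star l c ^+ 5 - ry_star l c ^+ 2 + 3 * c = 0.
Proof.
move=> /andP[l0 l1] c0.
suff [r rP] : exists r : R, 0 < r /\ l * r ^+ 5 - r ^+ 2 + 3 * c = 0.
  exact: (@getI _ [set r : R | 0 < r /\ _]%classic r rP).
pose P : {poly R} := l *: 'X^5 - 'X^2 + (3 * c)%:P.
have PE x : P.[x] = l * x ^+ 5 - x ^+ 2 + 3 * c.
  by rewrite /P !hornerE.
(* With this [M >= 1] the leading term is [(2 - 3 * c) * M ^+ 4], at least [(2 - 3 * c) * M ^+ 2],
   so the quintic is positive at [M]. *)
pose M := l^-1 * (2 - 3 * c).
have lM : l * M = 2 - 3 * c by rewrite mulrA divff ?mul1r ?gt_eqF.
have M1 : 1 <= M.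
  have : l * 1 <= l * M by rewrite lM; lra.
  by rewrite ler_pM2l.
have [|x /andP[x1 _] /rootP] := @poly_ivt R P 1 M M1.
  rewrite !PE; apply/andP; split; first by rewrite !expr1n; lra.
  rewrite exprS mulrA lM.
  have M2 : 1 <= M ^+ 2 by rewrite exprn_ege1.
  have M4 : M ^+ 2 <= M ^+ 4.
    by rewrite -[4%N]/(2 + 2)%N exprD ler_peMl // ltW// (lt_le_trans ltr01).
  have : (2 - 3 * c) * M ^+ 2 <= (2 - 3 * c) * M ^+ 4 by rewrite ler_pM2l//; lra.
  nra.
by rewrite PE => Px; exists x; split=> //; apply: lt_le_trans x1.
Qed.

(** If [r <= 1], then [l * r ^+ 5 < r ^+ 5 <= r ^+ 2], and with [c < 0] the left side of the
    equation is negative. *)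
Lemma root_gt1 l c r : l < 1 -> c < 0 -> 0 < r ->
  l * r ^+ 5 - r ^+ 2 + 3 * c = 0 -> 1 < r.
Proof.
move=> l1 c0 r0 rE; rewrite ltNge; apply/negP => r1.
have r2 : 0 < r ^+ 2 by rewrite exprn_gt0.
have r3 : r ^+ 3 <= 1 by rewrite exprn_ile1// ltW.
have r5 : r ^+ 5 <= r ^+ 2.
  by rewrite -[5%N]/(2 + 3)%N exprD ler_piMr// ltW.
have r50 : 0 < r ^+ 5 by rewrite exprn_gt0.
have : l * r ^+ 5 < r ^+ 5 by rewrite gtr_pMl.
lra.
Qed.

Lemma root_eq l c r : 0 < r -> l * r ^+ 5 - r ^+ 2 + 3 * c = 0 ->
  l = r^-1 ^+ 3 - 3 * c * r^-1 ^+ 5.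
Proof.
move=> r0 rE; have rn0 : r != 0 by rewrite gt_eqF.
have -> : l = (l * r ^+ 5 - r ^+ 2 + 3 * c) * r^-1 ^+ 5
              + r^-1 ^+ 3 - 3 * c * r^-1 ^+ 5 by field.
by rewrite rE mul0r add0r.
Qed.

(** By [root_eq], for [c < 0] the coefficient [l] is an increasing function of [r^-1]. *)
Lemma root_antitone l l' c r r' : c < 0 -> 0 < r -> 0 < r' ->
  l * r ^+ 5 - r ^+ 2 + 3 * c = 0 -> l' * r' ^+ 5 - r' ^+ 2 + 3 * c = 0 ->
  l < l' -> r' <= r.
Proof.
move=> c0 r0 r'0 /(root_eq r0) -> /(root_eq r'0) -> ll'.
rewrite leNgt; apply/negP => rr'; move: ll'; apply/negP; rewrite -leNgt.
have h : r'^-1 <= r^-1 by rewrite lef_pV2// ltW.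
have h0 : 0 <= r'^-1 by rewrite invr_ge0 ltW.
have h3 : r'^-1 ^+ 3 <= r^-1 ^+ 3 by rewrite lerXn2r// nnegrE (le_trans h0).
have h5 : r'^-1 ^+ 5 <= r^-1 ^+ 5 by rewrite lerXn2r// nnegrE (le_trans h0).
nra.
Qed.

(* The quantity [q] of the header. *)
Definition oblate_term l c : R := - 6 * c * (ry_star l c)^-1 ^+ 5.

Lemma oblate_term_bounds l c : 0 < l < 1 -> - (1 / 1000) < c < 0 ->
  0 < oblate_term l c < 6 / 1000.
Proof.
move=> l01 /andP[c1 c0]; have [r0 rE] := ry_starP l01 c0.
have r1 := root_gt1 (andP l01).2 c0 r0 rE.
rewrite /oblate_term; set h := _^-1 ^+ 5.
have h0 : 0 < h by rewrite exprn_gt0// invr_gt0.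
have h1 : h <= 1.
  by rewrite exprn_ile1// ?invr_ge0 ?invf_le1// ltW.
apply/andP; split; nra.
Qed.

Lemma oblate_term_monotone l l' c : 0 < l < 1 -> 0 < l' < 1 -> c < 0 ->
  l < l' -> oblate_term l c <= oblate_term l' c.
Proof.
move=> l01 l'01 c0 ll'.
have [r0 rE] := ry_starP l01 c0; have [r'0 r'E] := ry_starP l'01 c0.
have r'r := root_antitone c0 r0 r'0 rE r'E ll'.
rewrite /oblate_term ler_pM2l; last by lra.
by apply: lerXn2r; rewrite ?nnegrE ?invr_ge0 ?(ltW r0) ?(ltW r'0)// lef_pV2.
Qed.

(** The coefficients [A] and [B] at the equilibrium, where [Omega_xx] is [3 * d] and [Omega_yy] is
    [9 / 2 * (1 - d) + q]. *)
Definition coefA d q : R := 4 - 3 * d - (9 / 2 * (1 - d) + q).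
Definition coefB d q : R := 3 * d * (9 / 2 * (1 - d) + q).
Definition discriminant d q : R := coefA d q ^+ 2 - 4 * coefB d q.

Lemma coefA_bounds d q : 1 / 2 < d < 1 -> 0 < q < 6 / 1000 ->
  0 < coefA d q <= 1.
Proof.
by rewrite /coefA => /andP[? ?] /andP[? ?]; apply/andP; split; lra.
Qed.

Lemma coefB_gt0 d q : 1 / 2 < d < 1 -> 0 < q < 6 / 1000 -> 0 < coefB d q.
Proof.
rewrite /coefB => /andP[? ?] /andP[? ?]; apply: mulr_gt0; lra.
Qed.

Lemma discriminantE d q : discriminant d q =
  q * (q - (15 * d - 1)) + (225 / 4 * d ^+ 2 - 111 / 2 * d + 1 / 4).
Proof. by rewrite /discriminant /coefA /coefB; field. Qed.

(** The increment is the sum of the two products below: [d] moves with [q'] fixed, then [q] moves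
    with [d] fixed. The first is positive because [d + d' > 1] and [225 / 4 - 111 / 2 = 3 / 4]
    exceeds [15 * q']; the second is nonnegative because [15 * d - 1] dominates [q + q']. *)
Lemma discriminant_lt d d' q q' : 1 / 2 < d -> d < d' ->
  0 < q < 6 / 1000 -> 0 < q' <= q -> discriminant d q < discriminant d' q'.
Proof.
move=> d1 dd' /andP[q0 q1] /andP[q'0 q'q]; rewrite !discriminantE.
have : 0 < (d' - d) * (225 / 4 * (d + d') - 111 / 2 - 15 * q').
  by apply: mulr_gt0; lra.
have : 0 <= (q - q') * (15 * d - 1 - q - q') by apply: mulr_ge0; lra.
lra.
Qed.

Lemma discriminant_gt0 d q : 99 / 100 <= d < 1 -> 0 < q < 6 / 1000 ->
  0 < discriminant d q.
Proof. by rewrite discriminantE => /andP[? ?] /andP[? ?]; nra. Qed.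

Lemma discriminant_lt0 d q : 1 / 2 < d < 6 / 10 -> 0 < q < 6 / 1000 ->
  discriminant d q < 0.
Proof. by rewrite discriminantE => /andP[? ?] /andP[? ?]; nra. Qed.

(* Monotonicity makes continuity unnecessary: [s] is the supremum of the points
   where [f] is nonnegative. *)
Lemma sign_change (f : R -> R) (a b m m' : R) :
  a < m -> m' < b -> 0 < f m -> f m' < 0 -> m < m' ->
  (forall x y, a < x -> x < y -> y <= b -> f y < f x) ->
  exists2 s, a < s < b & forall x, a < x <= b ->
    (x < s -> 0 < f x) /\ (s < x -> f x < 0).
Proof.
move=> am m'b fm fm' mm' fdec.
pose S := [set x | a < x <= b /\ 0 <= f x]%classic.
have Sm : S m.
  by split; [rewrite am/= ltW// (lt_trans mm')|exact: ltW].
have ubS : ubound S m'.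
  move=> x [/andP[ax xb] fx]; rewrite leNgt; apply/negP => m'x.
  have := fdec _ _ (lt_trans am mm') m'x xb.
  by rewrite ltNge (le_trans (ltW fm') fx).
have supS : has_sup S by split; [exists m|exists m'].
exists (sup S).
  apply/andP; split; first exact: lt_le_trans am (ub_le_sup supS.2 Sm).
  by apply: le_lt_trans m'b; apply: ge_sup => //; exists m.
move=> x /andP[ax xb]; split.
- move=> /(sup_gt supS.1)[z [/andP[az zb] fz] xz].
  exact: le_lt_trans fz (fdec _ _ ax xz zb).
- move=> sx; rewrite ltNge; apply/negP => fx.
  have : x <= sup S by apply: (ub_le_sup supS.2); split => //; apply/andP.
  by rewrite leNgt sx.
Qed.

End Equilibrium.

(** * From the signs of [A], [B] and the discriminant to the eigenvalues *)

Section Spectrum.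
Variable R : realType.

(** The squared frequencies are the roots [(A + e) / 2] and [(A - e) / 2] of [t ^+ 2 - A * t + B],
    with [e] the root of the discriminant; [B > 0] gives [e < A], so both are positive. *)
Lemma biquadratic_imaginary_roots (A B : R) :
  0 < A -> 0 < B -> 0 <= A ^+ 2 - 4 * B ->
  exists w w' : R, [/\ 0 < w, 0 < w', w ^+ 2 + w' ^+ 2 = A,
    w ^+ 2 * w' ^+ 2 = B & 0 < A ^+ 2 - 4 * B -> w' < w].
Proof.
set D := A ^+ 2 - 4 * B => A0 B0 D0.
pose e := Num.sqrt D.
have e0 : 0 <= e by exact: sqrtr_ge0.
have eE : e ^+ 2 = A ^+ 2 - 4 * B by exact: sqr_sqrtr.
have eA : e < A.
  by rewrite -(@ltr_pXn2r _ 2) ?nnegrE ?(ltW A0)// eE; lra.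
pose w := Num.sqrt ((A + e) / 2); pose w' := Num.sqrt ((A - e) / 2).
have wE : w ^+ 2 = (A + e) / 2 by apply: sqr_sqrtr; lra.
have w'E : w' ^+ 2 = (A - e) / 2 by apply: sqr_sqrtr; lra.
have w0 : 0 < w by rewrite sqrtr_gt0; lra.
have w'0 : 0 < w' by rewrite sqrtr_gt0; lra.
exists w, w'; split => // [||D_gt0].
- by rewrite wE w'E; field.
- rewrite wE w'E; have -> : (A + e) / 2 * ((A - e) / 2) = (A ^+ 2 - e ^+ 2) / 4.
    by field.
  by rewrite eE; field.
- have e_gt0 : 0 < e by rewrite sqrtr_gt0.
  by rewrite -(@ltr_pXn2r _ 2) ?nnegrE ?ltW// wE w'E; lra.
Qed.

(** For a root [x +i* y], the squared modulus is the square root [k] of [B] and the real part of the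
    square is [- A / 2]; solving gives [x] and [y]. A negative discriminant means [A < 2 * k], hence
    [x > 0]. *)
Lemma biquadratic_complex_roots (A B : R) :
  0 < A -> 0 < B -> A ^+ 2 - 4 * B < 0 ->
  exists x y : R, [/\ 0 < x, 0 < y, 2 * (y ^+ 2 - x ^+ 2) = A
                    & (x ^+ 2 + y ^+ 2) ^+ 2 = B].
Proof.
move=> A0 B0 D0.
pose k := Num.sqrt B.
have k0 : 0 < k by rewrite sqrtr_gt0.
have kE : k ^+ 2 = B by apply: sqr_sqrtr; exact: ltW.
have kA : A < 2 * k.
  by rewrite -(@ltr_pXn2r _ 2) ?nnegrE ?(ltW A0) ?mulr_ge0 ?(ltW k0)//
     exprMn kE; lra.
pose x := Num.sqrt ((2 * k - A) / 4); pose y := Num.sqrt ((2 * k + A) / 4).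
have xE : x ^+ 2 = (2 * k - A) / 4 by apply: sqr_sqrtr; lra.
have yE : y ^+ 2 = (2 * k + A) / 4 by apply: sqr_sqrtr; lra.
exists x, y; split; [by rewrite sqrtr_gt0; lra..| |].
- by rewrite xE yE; field.
- by rewrite xE yE -kE; field.
Qed.

Lemma prod_opp_pairs (s1 s2 s3 : R[i]) :
  \prod_(rho <- [:: s1; - s1; s2; - s2; s3; - s3]) ('X - rho%:P) =
  ('X^2 - (s1 ^+ 2)%:P) * ('X^4 + (- (s2 ^+ 2) - s3 ^+ 2)%:P * 'X^2
                           + (s2 ^+ 2 * s3 ^+ 2)%:P).
Proof.
rewrite !big_cons big_nil !(polyCB, polyCN, polyCM, rmorphXn) /=.
by ring.
Qed.

Variables (a b g : R).
Let J : 'M[R]_6 := \matrix_(i < 6, j < 6) (nth [::] (linear_block a b g) i)`_j.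
Let A : R := 4 - a - b.
Let B : R := a * b.

Lemma char_poly_complexify : char_poly (complexify J) =
  ('X^2 - (g%:C)%:P) * ('X^4 + (A%:C)%:P * 'X^2 + (B%:C)%:P).
Proof.
rewrite /complexify -map_char_poly char_poly_linear_block.
(* Hiding the bodies of [A] and [B] keeps the morphism rules from entering them. *)
rewrite -/A -/B; move: A B => A' B'.
rewrite rmorphM rmorphB !rmorphD (rmorphM _ A'%:P 'X^2) /=.
by rewrite !map_polyXn !map_polyC.
Qed.

(** The characteristic polynomial is even, so it suffices to match squares: [g] for the vertical
    pair, and the Vieta relations of [t ^+ 2 + A * t + B] for the planar pairs. *)
Lemma has_spectrum_opp_pairs (s1 s2 s3 : R[i]) : s1 ^+ 2 = g%:C ->
  s2 ^+ 2 + s3 ^+ 2 = (- A)%:C -> s2 ^+ 2 * s3 ^+ 2 = B%:C ->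
  has_spectrum J [:: s1; - s1; s2; - s2; s3; - s3].
Proof.
move=> e1 e2 e3; rewrite /has_spectrum char_poly_complexify prod_opp_pairs.
by rewrite e1 e3 -opprD e2 (rmorphN (real_complex R)) opprK.
Qed.

Lemma imaginary_sqr (w : R) : (0 +i* w) ^+ 2 = (- w ^+ 2)%:C.
Proof.
by rewrite expr2; apply/eqP; rewrite eq_complex /=; apply/andP; split;
  apply/eqP; ring.
Qed.

Lemma opp_imaginary (w : R) : - (0 +i* w) = 0 -i* w.
Proof. by apply/eqP; rewrite eq_complex /= oppr0 !eqxx. Qed.

(** The minimal polynomial divides the characteristic one, which here is a product of distinct
    linear factors. *)
Lemma has_spectrum_diagonalizable (rs : seq R[i]) :
  uniq rs -> has_spectrum J rs -> diagonalizable (complexify J).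
Proof.
move=> urs sJ; apply/diagonalizableP; exists rs => //.
by rewrite -sJ; exact: mxminpoly_dvd_char.
Qed.

Hypotheses (g1 : g < - 1) (A01 : 0 < A <= 1) (B0 : 0 < B).

(** A zero discriminant is included so that the spectrum can be listed at the critical mass ratio
    too; the planar frequencies then coincide, and diagonalizability is claimed only for a positive
    discriminant. *)
Lemma spectrum_centers : 0 <= A ^+ 2 - 4 * B ->
  exists w1 w2 w3 : R, [/\ 0 < w1, 0 < w2, 0 < w3,
    has_spectrum J [:: 0 +i* w1; - (0 +i* w1); 0 +i* w2; - (0 +i* w2);
                       0 +i* w3; - (0 +i* w3)] &
    0 < A ^+ 2 - 4 * B -> diagonalizable (complexify J)].
Proof.
move=> D0; have /andP[A0 A1] := A01.
have [w2 [w3 [w20 w30 wD wM w32]]] := biquadratic_imaginary_roots A0 B0 D0.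
pose w1 := Num.sqrt (- g).
have g0 : 0 < - g by rewrite oppr_gt0 (lt_trans g1)// ltrN10.
have w1E : w1 ^+ 2 = - g by rewrite sqr_sqrtr// ltW.
have w10 : 0 < w1 by rewrite sqrtr_gt0.
have sJ : has_spectrum J [:: 0 +i* w1; - (0 +i* w1); 0 +i* w2; - (0 +i* w2);
                             0 +i* w3; - (0 +i* w3)].
  apply: has_spectrum_opp_pairs; rewrite !imaginary_sqr.
  - by rewrite w1E opprK.
  - by rewrite -rmorphD /= -opprD wD.
  - by rewrite -rmorphM /= mulrNN wM.
exists w1, w2, w3; split => // D_gt0.
apply: has_spectrum_diagonalizable sJ.
have w23 := w32 D_gt0.
(* The chain is [w2 ^+ 2 < w2 ^+ 2 + w3 ^+ 2 = A <= 1 < - g = w1 ^+ 2]. Hence [w3 < w2 < w1], and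
   the six eigenvalues are distinct. *)
have w12 : w2 < w1.
  rewrite -(@ltr_pXn2r _ 2) ?nnegrE ?ltW// w1E.
  have w2A : w2 ^+ 2 < A by rewrite -wD ltrDl exprn_gt0.
  by rewrite (lt_trans w2A)// (le_lt_trans A1)// ltrNr.
rewrite /= !inE !eq_complex /= !negb_or oppr0 !eqxx /=.
by do !(apply/andP; split) => //; apply/eqP; lra.
Qed.

Lemma spectrum_saddle : A ^+ 2 - 4 * B < 0 ->
  exists w x y : R, [/\ 0 < w, 0 < x, 0 < y &
    has_spectrum J [:: 0 +i* w; - (0 +i* w); x +i* y; - (x +i* y);
                       x -i* y; - (x -i* y)]].
Proof.
move=> D0; have /andP[A0 A1] := A01.
have [x [y [x0 y0 xyD xyM]]] := biquadratic_complex_roots A0 B0 D0.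
pose w := Num.sqrt (- g).
have g0 : 0 < - g by rewrite oppr_gt0 (lt_trans g1)// ltrN10.
have wE : w ^+ 2 = - g by rewrite sqr_sqrtr// ltW.
exists w, x, y; split => //; first by rewrite sqrtr_gt0.
have e2 : (x +i* y) ^+ 2 = (x ^+ 2 - y ^+ 2) +i* (2 * x * y).
  by rewrite [LHS]expr2; apply/eqP; rewrite eq_complex /=; apply/andP; split;
    apply/eqP; ring.
have e3 : (x -i* y) ^+ 2 = (x ^+ 2 - y ^+ 2) -i* (2 * x * y).
  by rewrite [LHS]expr2; apply/eqP; rewrite eq_complex /=; apply/andP; split;
    apply/eqP; ring.
apply: has_spectrum_opp_pairs; rewrite ?imaginary_sqr ?wE ?opprK// e2 e3.
- by apply/eqP; rewrite eq_complex /= subrr eqxx andbT -xyD; apply/eqP; ring.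
- rewrite -xyM; apply/eqP; rewrite eq_complex /=.
  by apply/andP; split; apply/eqP; ring.
Qed.

End Spectrum.

(** * Dependence of [v], [d] and the discriminant on the masses *)

Section MassRatio.
Variable R : realType.
Implicit Types (c d m mu v : R).

(* [c] and [m3] determine [R3 ^+ 2 * C20], hence [v]; this is why the
   critical [mu] depends on [c] and [m3] only. *)
Definition v_of_masses m c : R := (1 / (1 - 3 * c * m `^ (2 / 3))) `^ (1 / 3).

(** The powers of [m3] cancel: [R3 ^+ 2 * C20 / 2] equals c times [m3] to the power [2 / 3]. *)
Lemma v_parE (m3 : R) c (R3 C20 : R) : 0 < m3 -> c = c_par m3 R3 C20 ->
  v_par R3 C20 = v_of_masses m3 c.
Proof.
move=> m0 ->; rewrite /v_par /v_of_masses /c_par powRN.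
have m20 : m3 `^ (2 / 3) != 0 by rewrite gt_eqF// powR_gt0.
by congr ((1 / (1 - _)) `^ _); field.
Qed.

Lemma v_of_masses_bounds (m3 : R) c : 0 < m3 <= 1 / 3 -> - (1 / 1000) < c < 0 ->
  99 / 100 < v_of_masses m3 c < 1.
Proof.
move=> /andP[m0 m1] /andP[c1 c0]; rewrite /v_of_masses.
have p0 : 0 < m3 `^ (2 / 3) by rewrite powR_gt0.
have p1 : m3 `^ (2 / 3) <= 1.
  apply: (@le_trans _ _ (1 `^ (2 / 3))); last by rewrite powR1.
  by apply: ge0_ler_powR; rewrite ?nnegrE; lra.
move: p0 p1; set k := m3 `^ _ => p0 p1.
have [k0 k1] : 0 < - c * k /\ - c * k < 1 / 1000 by split; nra.
set w := 1 / _.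
have den : 0 < 1 - 3 * c * k by lra.
have w1 : 99 / 100 < w by rewrite /w ltr_pdivlMr//; lra.
have w2 : w < 1 by rewrite /w ltr_pdivrMr//; lra.
have w0 : 0 <= w by lra.
set v := w `^ _.
have v0 : 0 <= v by exact: powR_ge0.
(* Cubing removes the real power; once [v < 1] is known, [v >= v ^+ 3 = w] transfers the lower
   bound. *)
have vE : v ^+ 3 = w.
  by rewrite -powR_mulrn// -powRrM (_ : 1 / 3 * _ = 1) ?powRr1//; field.
have v1 : v < 1.
  by rewrite -(@ltr_pXn2r _ 3) ?nnegrE// vE expr1n.
apply/andP; split=> //; apply: lt_le_trans w1 _.
by rewrite -vE exprS ler_piMr// exprn_ile1// ltW.
Qed.

Lemma mu_sub_sqr_bounds mu : 0 < mu <= 1 / 2 -> 0 < mu - mu ^+ 2 <= 1 / 4.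
Proof.
move=> /andP[mu0 mu1]; have := sqr_ge0 (mu - 1 / 2).
by rewrite sqrrB => ?; apply/andP; split; nra.
Qed.

(** The product [v ^+ 2 * (4 - v ^+ 2)] increases with [v] up to the value [3] at [v = 1]. As
    [mu - mu ^+ 2 <= 1 / 4], the radicand stays above [1 / 4], so the square root is genuine. *)
Lemma d_par_sqr v mu : 99 / 100 < v < 1 -> 0 < mu <= 1 / 2 ->
  d_par v mu ^+ 2 = 1 - v ^+ 2 * (4 - v ^+ 2) * (mu - mu ^+ 2) /\
  29 / 10 < v ^+ 2 * (4 - v ^+ 2) < 3.
Proof.
move=> /andP[v1 v2] /mu_sub_sqr_bounds/andP[m0 m1].
have [u1 u2] : 98 / 100 < v ^+ 2 /\ v ^+ 2 < 1 by split; nra.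
have P : 29 / 10 < v ^+ 2 * (4 - v ^+ 2) < 3 by apply/andP; split; nra.
split => //; apply: sqr_sqrtr; case/andP: P.
move: m0 m1; set p := _ * (4 - _); set m := mu - _ => m0 m1 p1 p2; nra.
Qed.

Lemma d_par_bounds v mu : 99 / 100 < v < 1 -> 0 < mu <= 1 / 2 ->
  1 / 2 < d_par v mu < 1.
Proof.
move=> v1 mu01; have [] := d_par_sqr v1 mu01.
have d0 : 0 <= d_par v mu by exact: sqrtr_ge0.
have := mu_sub_sqr_bounds mu01.
set p := _ * (4 - _); set m := mu - _ => /andP[m0 m1] dE /andP[p1 p2].
have pm : 0 < (3 - p) * m by apply: mulr_gt0; lra.
have pm0 : 0 < p * m by apply: mulr_gt0; lra.
apply/andP; split.
  by rewrite -(@ltr_pXn2r _ 2) ?nnegrE// dE; nra.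
by rewrite -(@ltr_pXn2r _ 2) ?nnegrE// dE; nra.
Qed.

(** The function [mu - mu ^+ 2] is increasing up to [1 / 2], its increment being
    [(mu' - mu) * (1 - mu - mu')]. *)
Lemma d_par_decr v mu mu' : 99 / 100 < v < 1 -> 0 < mu -> mu < mu' ->
  mu' <= 1 / 2 -> d_par v mu' < d_par v mu.
Proof.
move=> v1 mu0 mumu' mu'1.
have [|dE P] := @d_par_sqr v mu v1; first by rewrite mu0/=; lra.
have [|d'E _] := @d_par_sqr v mu' v1; first by rewrite mu'1 andbT; lra.
rewrite -(@ltr_pXn2r _ 2) ?nnegrE ?sqrtr_ge0// dE d'E.
case/andP: P; set p := _ * (4 - _) => p1 p2.
have : 0 < (mu' - mu) * (1 - mu - mu') by apply: mulr_gt0; lra.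
by nra.
Qed.

Lemma d_par_near1 v : 99 / 100 < v < 1 -> 99 / 100 <= d_par v (1 / 1000).
Proof.
move=> v1; have [|dE /andP[]] := @d_par_sqr v (1 / 1000) v1; first by lra.
have d0 : 0 <= d_par v (1 / 1000) by exact: sqrtr_ge0.
move=> p1 p2; rewrite -(@ler_pXn2r _ 2) ?nnegrE ?divr_ge0// dE.
by move: p1 p2; set p := _ * (4 - _) => p1 p2; lra.
Qed.

Lemma d_par_far1 v : 99 / 100 < v < 1 -> d_par v (2 / 5) < 6 / 10.
Proof.
move=> v1; have [|dE /andP[]] := @d_par_sqr v (2 / 5) v1; first by lra.
have d0 : 0 <= d_par v (2 / 5) by exact: sqrtr_ge0.
move=> p1 p2; rewrite -(@ltr_pXn2r _ 2) ?nnegrE ?divr_ge0// dE.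
by move: p1 p2; set p := _ * (4 - _) => p1 p2; lra.
Qed.

Lemma lambda1_bounds v mu : 99 / 100 < v < 1 -> 0 < mu <= 1 / 2 ->
  0 < lambda1 v mu < 1.
Proof.
by move=> v1 /(d_par_bounds v1)/andP[? ?]; rewrite /lambda1; lra.
Qed.

Lemma critical_mass_ratio v c : 99 / 100 < v < 1 -> - (1 / 1000) < c < 0 ->
  exists2 mustar, 0 < mustar < 1 / 2 & forall mu, 0 < mu <= 1 / 2 ->
    let D := discriminant (d_par v mu) (oblate_term (lambda1 v mu) c) in
    (mu < mustar -> 0 < D) /\ (mustar < mu -> D < 0).
Proof.
move=> v1 c1; pose f mu :=
  discriminant (d_par v mu) (oblate_term (lambda1 v mu) c).
have q mu : 0 < mu <= 1 / 2 -> 0 < oblate_term (lambda1 v mu) c < 6 / 1000.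
  by move=> mu01; apply: oblate_term_bounds => //; exact: lambda1_bounds.
(* The discriminant is tested at [1 / 1000], where [d >= 99 / 100], and at [2 / 5], where
   [d < 6 / 10]. *)
apply: (@sign_change R f 0 (1 / 2) (1 / 1000) (2 / 5)); [lra|lra| | |lra|].
- have m01 : 0 < (1 / 1000 : R) <= 1 / 2 by lra.
  apply: discriminant_gt0 (q _ m01); have /andP[_ ->] := d_par_bounds v1 m01.
  by rewrite d_par_near1.
- have m01 : 0 < (2 / 5 : R) <= 1 / 2 by lra.
  apply: discriminant_lt0 (q _ m01); have /andP[-> _] := d_par_bounds v1 m01.
  by rewrite d_par_far1.
- move=> mu mu' mu0 mumu' mu'1.
  have mu01 : 0 < mu <= 1 / 2 by lra.
  have mu'01 : 0 < mu' <= 1 / 2 by lra.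
  have dd' := d_par_decr v1 mu0 mumu' mu'1.
  have /andP[d'1 _] := d_par_bounds v1 mu'01.
  (* As [mu] grows, [d] decreases, so [lambda1] grows and the oblate term does not decrease. *)
  apply: discriminant_lt => //; first exact: q.
  have /andP[-> _] := q _ mu01; apply: oblate_term_monotone.
  + exact: lambda1_bounds.
  + exact: lambda1_bounds.
  + by case/andP: c1.
  + by rewrite /lambda1; lra.
Qed.

End MassRatio.

(** * Second derivatives at the two equilibria, [sgn] selecting the half-axis *)

Section YAxisEquilibrium.
Variables (R : realType) (l1 l2 c : R) (sgn : bool).
Hypotheses (l01 : 0 < l1 < 1) (c0 : c < 0).
Let r := ry_star l1 c.
Let y : R := (-1) ^+ sgn * r.

Lemma inv_radius_equilibrium : inv_radius 0 y 0 = r^-1.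
Proof.
have [r0 _] := ry_starP l01 c0.
rewrite /inv_radius expr0n addr0 add0r sqrtr_sqr /y normrM normr_sign mul1r.
by rewrite gtr0_norm.
Qed.

Lemma equilibrium_neq0 : y != 0.
Proof.
have [r0 _] := ry_starP l01 c0.
by rewrite /y mulf_neq0 ?signr_eq0 ?gt_eqF.
Qed.

(** This is the equilibrium condition [force_y = 0] divided by [y]. *)
Lemma force_factor_equilibrium : force_factor c 0 y 0 = - l1.
Proof.
have [r0 rE] := ry_starP l01 c0.
rewrite /force_factor inv_radius_equilibrium [in RHS](root_eq r0 rE).
by rewrite -/r; ring.
Qed.

Lemma Omega_xx_equilibrium : Omega_xx l1 l2 c 0 y 0 = l2 - l1.
Proof.
by rewrite Omega_xx_y_axis ?equilibrium_neq0// force_factor_equilibrium.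
Qed.

(** With [h = r^-1], the extra term is [3 * h ^+ 3 - 15 * c * h ^+ 5]; [root_eq] turns it into
    [3 * l1 - 6 * c * h ^+ 5]. *)
Lemma Omega_yy_equilibrium :
  Omega_yy l1 l2 c 0 y 0 = 3 * l1 + oblate_term l1 c.
Proof.
have [r0 rE] := ry_starP l01 c0.
rewrite Omega_yy_y_axis ?equilibrium_neq0// force_factor_equilibrium.
rewrite inv_radius_equilibrium /y exprMn sqrr_sign mul1r /oblate_term -/r.
rewrite [in RHS](root_eq r0 rE) -/r; have rn0 : r != 0 by rewrite gt_eqF.
by field.
Qed.

Lemma Omega_zz_equilibrium :
  Omega_zz l1 l2 c 0 y 0 = - 1 - l1 - oblate_term l1 c.
Proof.
rewrite Omega_zz_y_axis ?equilibrium_neq0// force_factor_equilibrium.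
by rewrite inv_radius_equilibrium /oblate_term -/r; ring.
Qed.

End YAxisEquilibrium.

Theorem proposition4p3 (R : realType) :
  exists2 c0 : R, 0 < c0 &
  forall m3 c : R, 0 < m3 <= 1 / 3 -> - c0 < c < 0 ->
  exists2 mustar : R, 0 < mustar < 1 / 2 &
  forall R3 C20 : R, 0 < R3 -> C20 < 0 -> c = c_par m3 R3 C20 ->
  forall (mu : R) (sgn : bool), 0 < mu <= 1 / 2 ->
  let l1 : R := lambda1 (v_par R3 C20) mu in
  let l2 : R := lambda2 (v_par R3 C20) mu in
  let y : R := (-1) ^+ sgn * ry_star l1 c in
  let J := linearization l1 l2 c y in
  [/\ Omega_zz l1 l2 c 0 y 0 < 0,
      0 < hillA l1 l2 c 0 y 0,
      0 < hillB l1 l2 c 0 y 0,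
      (mu < mustar -> 0 < hillD l1 l2 c 0 y 0) &
      (mustar < mu -> hillD l1 l2 c 0 y 0 < 0)] /\
  (exists (w : R) (rho1 rho2 : R[i]),
     [/\ 0 < w,
         has_spectrum J [:: 0 +i* w; 0 -i* w; rho1; - rho1; rho2; - rho2],
         (mu < mustar -> purely_imaginary rho1 /\ purely_imaginary rho2) &
         (mustar < mu ->
            [/\ complex.Re rho1 <> 0, complex.Im rho1 <> 0 &
                rho2 = rho1^*])]) /\
  (mu < mustar -> center_center_center J) /\
  (mustar < mu -> center_complex_saddle J).
Proof.
(* This bound keeps the oblate term below [6 / 1000] and [v] above [99 / 100], as the sign estimates
   require. *)
exists (1 / 1000); first by lra.
move=> m3 c m301 c1.
have v1 := v_of_masses_bounds m301 c1.
have [mustar mustar01 Dsign] := critical_mass_ratio v1 c1.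
exists mustar => // R3 C20 _ _ cE mu sgn mu01 l1 l2 y J.
have [m30 _] := andP m301; have [_ c0] := andP c1.
rewrite -(v_parE m30 cE) in v1 Dsign.
have [Dpos Dneg] := Dsign mu mu01.
have d1 := d_par_bounds v1 mu01; have l1_01 := lambda1_bounds v1 mu01.
have q1 := oblate_term_bounds l1_01 c1.
have y0 : y != 0 := equilibrium_neq0 sgn l1_01 c0.
have xx := Omega_xx_equilibrium l2 sgn l1_01 c0.
have yy := Omega_yy_equilibrium l2 sgn l1_01 c0.
have zz := Omega_zz_equilibrium l2 sgn l1_01 c0.
rewrite -/l1 -/y in xx yy zz.
rewrite -/l1 in l1_01 q1 Dpos Dneg.
set d := d_par _ _ in d1 Dpos Dneg.
set q := oblate_term _ _ in q1 Dpos Dneg yy zz.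
have l1E : l1 = 3 / 2 * (1 - d) by [].
have l2E : l2 = 3 / 2 * (1 + d) by [].
have AE : 4 - Omega_xx l1 l2 c 0 y 0 - Omega_yy l1 l2 c 0 y 0 = coefA d q.
  by rewrite xx yy l1E l2E /coefA; field.
have BE : Omega_xx l1 l2 c 0 y 0 * Omega_yy l1 l2 c 0 y 0 = coefB d q.
  by rewrite xx yy l1E l2E /coefB; field.
have A01 := coefA_bounds d1 q1; have B0 := coefB_gt0 d1 q1.
have z1 : Omega_zz l1 l2 c 0 y 0 < - 1.
  by rewrite zz; case/andP: l1_01 => ? ?; case/andP: q1 => ? ?; lra.
rewrite /hillD /hillA /hillB AE BE.
have JE := linearizationE l1 l2 c y0; rewrite -/J in JE.
split; first by split => //; [exact: lt_trans z1 (ltrN10 _)|case/andP: A01].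
rewrite JE; rewrite -AE in A01; rewrite -BE in B0.
(* Splitting on the sign of the discriminant, not on the position of [mu], also covers
   [mu = mustar]; in each branch the implications of the other regime hold by contradiction. *)
have [D0|D0] := leP 0 (discriminant d q).
- have [|w1 [w2 [w3 [w10 w20 w30 sJ dJ]]]] := spectrum_centers z1 A01 B0.
    by rewrite AE BE.
  split; [exists w1, (0 +i* w2), (0 +i* w3); split=> //|split].
  + by rewrite -opp_imaginary.
  + by split; split => //=; apply/eqP; rewrite gt_eqF.
  + by move/Dneg; rewrite ltNge D0.
  + move=> /Dpos D_gt0; split; first by apply: dJ; rewrite AE BE.
    by exists w1, w2, w3; split => //; rewrite -!opp_imaginary.
  + by move/Dneg; rewrite ltNge D0.
- have [|w [a [b [w0 a0 b0 sJ]]]] := spectrum_saddle z1 A01 B0.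
    by rewrite AE BE.
  have Nab : - (a +i* b) = - a -i* b.
    by apply/eqP; rewrite eq_complex /= !eqxx.
  have Nab' : - (a -i* b) = - a +i* b.
    by apply/eqP; rewrite eq_complex /= opprK !eqxx.
  split; [exists w, (a +i* b), (a -i* b); split=> //|split].
  + by rewrite -opp_imaginary.
  + by move/Dpos; rewrite ltNge ltW.
  + by split => //=; apply/eqP; rewrite gt_eqF.
  + by move/Dpos; rewrite ltNge ltW.
  + move=> _; exists w, a, b; split => //.
    (* Both lists hold the same six eigenvalues, in opposite pairs and in conjugate pairs; the
       product is merely reordered. *)
    rewrite -opp_imaginary -Nab -Nab' /has_spectrum [LHS]sJ.
    by rewrite !big_cons big_nil; ring.
Qed.
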